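(* Let $F,G,B$ be $m\times m$ matrices over $\mathcal F$ with $F$ singular and $sF-G$ a regular pencil, and let $Q,J_p,H_q,B_p,B_q$ be the matrices obtained from the Weierstrass decomposition of $sF-G$. The finite discrete time system $$FX_{k+1}=GX_k+BV_k,\qquad X_k=QY_k,$$ with time points $0\le k\le M$, is controllable if and only if $$\mathrm{rank}\,[\,B_p\ \ J_pB_p\ \cdots\ J_p^{p-1}B_p\,]=p\quad\text{and}\quad \mathrm{rank}\,[\,B_q\ \ H_qB_q\ \cdots\ H_q^{q-1}B_q\,]=q .$$
   Context: Setting. $\mathcal F$ is a field over which the (complex) Weierstrass canonical form of the pencil $sF-G$ is available (e.g. $\mathcal F=\mathbb C$), $\mathcal M_{m1}=\mathcal F^{m\times 1}$, and $X_k,Y_k,V_k\in\mathcal M_{m1}$. The integer $M$ is the final time point. The pencil $sF-G$ is regular, i.e. $\det(sF-G)\not\equiv 0$. By the Weierstrass canonical form there are nonsingular $m\times m$ matrices $P,Q$ and integers $p,q$ with $p+q=m$ such that $$PFQ=\mathrm{blockdiag}(I_p,H_q),\qquad PGQ=\mathrm{blockdiag}(J_p,I_q),$$ where $J_p$ is a $p\times p$ Jordan matrix formed from the finite eigenvalues of the pencil and $H_q$ is a $q\times q$ block diagonal matrix whose blocks are nilpotent Jordan blocks (ones on the first superdiagonal, zeros elsewhere). Write $PB=\begin{bmatrix}B_p\\ B_q\end{bmatrix}$ with $B_p$ of size $p\times m$, $B_q$ of size $q\times m$, and $Y_k=\begin{bmatrix}Y^p_k\\ Y^q_k\end{bmatrix}$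 with $Y^p_k\in\mathcal F^p$, $Y^q_k\in\mathcal F^q$. In these coordinates the system is $$Y^p_{k+1}=J_pY^p_k+B_pV_k,\qquad H_qY^q_{k+1}=Y^q_k+B_qV_k\qquad(0\le k\le M-1),$$ and its solution for $0\le k\le M$ is $$Y^p_k=J_p^kY^p_0+\sum_{i=0}^{k-1}J_p^{k-i-1}B_pV_i,\qquad Y^q_k=H_q^{M-k}Y^q_M-\sum_{i=0}^{M-k-1}H_q^iB_qV_{k+i},$$ so that the trajectory is determined by the inputs together with the initial value $Y^p_0\in\mathcal F^p$ and the terminal value $Y^q_M\in\mathcal F^q$; the pair $(Y^p_0,Y^q_M)$ is called a complete set of conditions. Controllability. The finite discrete time system is called controllable if and only if for every $W\in\mathcal M_{m1}$ and any complete set of conditions $Y^p_0$, $Y^q_M$ there exist a time point $k_1$ with $0\le k_1\le M$ and a sequence of control inputs $V_0,V_1,\dots,V_M$ such that the corresponding trajectory satisfies $Y_{k_1}=W$.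
   Formalization: The ''if'' direction is proved only for a final time M ≥ m, since for short horizons it is false (e.g. m = 2, F = diag(1,0), G = B = I, M = 1); the ''only if'' direction is proved for every M. *)

(* Defs.v *)
From HB Require Import structures.
From mathcomp Require Import all_boot all_order all_algebra.

Set Implicit Arguments.
Unset Strict Implicit.
Unset Printing Implicit Defensive.

Import GRing.Theory.
Local Open Scope ring_scope.

Section Blocks.

Variables (K : fieldType) (p q m : nat) (epq : (p + q = m)%N).

(* As p + q and m need not be convertible, blocks are transported along
   epq : p + q = m. *)
Definition block_diag (A : 'M[K]_p) (D : 'M[K]_q) : 'M[K]_m :=
  castmx (epq, epq) (block_mx A 0 0 D).

Definition stack n (U : 'M[K]_(p, n)) (D : 'M[K]_(q, n)) : 'M[K]_(m, n) :=
  castmx (epq, erefl n) (col_mx U D).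

End Blocks.

Section Weierstrass.

Variable K : fieldType.

(* The matrix sF - G over K[s]; the finite eigenvalues of the pencil are the
   roots of its determinant. *)
Definition pencil m (F G : 'M[K]_m) : 'M[{poly K}]_m :=
  'X *: map_mx polyC F - map_mx polyC G.

Definition regular_pencil m (F G : 'M[K]_m) : Prop := \det (pencil F G) != 0.

Definition jordan_block n (a : K) : 'M[K]_n :=
  \matrix_(i, j) (a *+ (i == j) + ((i.+1 == j)%N)%:R).

(* A is block diagonal, its blocks being nonempty Jordan blocks whose
   eigenvalues all satisfy S; A is the empty matrix when there are no blocks. *)
Definition jordan_matrix (S : pred K) n (A : 'M[K]_n) : Prop :=
  exists (b : nat) (d : 'I_b -> nat) (a : 'I_b -> K)
         (e : (\sum_(i < b) d i = n)%N),
    (forall i, (0 < d i)%N /\ S (a i)) /\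
    A = castmx (e, e) (\mxdiag_(i < b) jordan_block (d i) (a i)).

Definition weierstrass_form m (F G P Q : 'M[K]_m) p q (epq : (p + q = m)%N)
    (J : 'M[K]_p) (H : 'M[K]_q) : Prop :=
  [/\ P \in unitmx /\ Q \in unitmx,
      P *m F *m Q = block_diag epq 1%:M H,
      P *m G *m Q = block_diag epq J 1%:M,
      jordan_matrix (root (\det (pencil F G))) J
    & jordan_matrix (pred1 0) H].

End Weierstrass.

Section Control.

Variable K : fieldType.

(* Sequences are indexed by nat, but only X_0, ..., X_M and V_0, ..., V_(M-1)
   are constrained. *)
Definition solves_system m (F G B : 'M[K]_m) (M : nat)
    (V X : nat -> 'cV[K]_m) : Prop :=
  forall k, (k < M)%N -> F *m X k.+1 = G *m X k + B *m V k.

(* Y is the trajectory, in the coordinates X = Q Y, with inputs V and complete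
   set of conditions (y0, yM). *)
Definition trajectory m (F G B Q : 'M[K]_m) p q (epq : (p + q = m)%N)
    (M : nat) (V : nat -> 'cV[K]_m) (y0 : 'cV[K]_p) (yM : 'cV[K]_q)
    (Y : nat -> 'cV[K]_m) : Prop :=
  [/\ solves_system F G B M V (fun k => Q *m Y k),
      exists yq : 'cV[K]_q, Y 0 = stack epq y0 yq
    & exists yp : 'cV[K]_p, Y M = stack epq yp yM].

(* When Q comes from a Weierstrass form, V, y0 and yM determine Y_0, ..., Y_M
   uniquely, so quantifying over Y existentially is harmless. *)
Definition controllable m (F G B Q : 'M[K]_m) p q (epq : (p + q = m)%N)
    (M : nat) : Prop :=
  forall (W : 'cV[K]_m) (y0 : 'cV[K]_p) (yM : 'cV[K]_q),
  exists (k1 : nat) (V Y : nat -> 'cV[K]_m),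
    [/\ (k1 <= M)%N, trajectory F G B Q epq M V y0 yM Y & Y k1 = W].

(* [ B  A B  ...  A^(n-1) B ] *)
Definition controllability_mx n m (A : 'M[K]_n) (B : 'M[K]_(n, m)) :=
  \mxrow_(i < n) (A ^+ i *m B).

End Control.

(* Main.v *)
Require Import Defs.
From HB Require Import structures.
From mathcomp Require Import all_boot all_order all_algebra.

Set Implicit Arguments.
Unset Strict Implicit.
Unset Printing Implicit Defensive.

Import GRing.Theory.
Local Open Scope ring_scope.

(** In the coordinates X = Q Y the system splits into two ordinary linear
recursions: the component in K^p runs forward in time from y0 with matrix Jp,
while the component in K^q runs backward in time from yM with matrix Hq, since
Hq Y^q_(k+1) = Y^q_k + Bq V_k computes Y^q_k from Y^q_(k+1). Thus both
components of a trajectory are values of one and the same object, the solution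
[state] of x_(j+1) = A x_j + N u_j (lemma [trajectoryE]). At time k the forward
component depends on V_0, ..., V_(k-1) only and the backward component on
V_k, ..., V_(M-1) only.

The theorem then follows from two facts about [state].
- Started at 0, it stays in the column space of [N  A N  ...  A^(n-1) N],
  because by Cayley-Hamilton every power of A is a combination of the first n
  ones ([state0_span]). If the system is controllable, the zero conditions
  y0 = 0, yM = 0 show that every vector lies in that column space, for both
  components, whatever the time k1 at which the target is hit.
- If that matrix has rank n, any target is reached at any time k >= n from any
  starting point ([state_reach]). For M >= m = p + q, both components can
  therefore be steered at time k1 = p: the forward one has p steps, the backward
  one has M - p >= q steps, and they use disjoint sets of inputs. *)

(** * Block coordinates *)

Section Blocks.

Variables (K : fieldType) (p q m : nat) (epq : (p + q = m)%N).

Lemma stack_inj n (U U' : 'M[K]_(p, n)) (D D' : 'M[K]_(q, n)) :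
  stack epq U D = stack epq U' D' -> U = U' /\ D = D'.
Proof. by case: m / epq; rewrite /stack !castmx_id => /eq_col_mx. Qed.

Lemma stack_surj n (A : 'M[K]_(m, n)) : exists U D, A = stack epq U D.
Proof.
case: m / epq A => A; exists (usubmx A), (dsubmx A).
by rewrite /stack castmx_id vsubmxK.
Qed.

Lemma stackD n (U U' : 'M[K]_(p, n)) (D D' : 'M[K]_(q, n)) :
  stack epq U D + stack epq U' D' = stack epq (U + U') (D + D').
Proof. by case: m / epq; rewrite /stack !castmx_id add_col_mx. Qed.

Lemma mul_stack n r (U : 'M[K]_(p, n)) (D : 'M[K]_(q, n)) (A : 'M[K]_(n, r)) :
  stack epq U D *m A = stack epq (U *m A) (D *m A).
Proof. by case: m / epq; rewrite /stack !castmx_id mul_col_mx. Qed.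

Lemma mul_block_diag_stack n (A : 'M[K]_p) (C : 'M[K]_q)
    (U : 'M[K]_(p, n)) (D : 'M[K]_(q, n)) :
  block_diag epq A C *m stack epq U D = stack epq (A *m U) (C *m D).
Proof.
case: m / epq; rewrite /stack /block_diag !castmx_id mul_block_col.
by rewrite !mul0mx addr0 add0r.
Qed.

End Blocks.

(** * Linear recursions and their reachable states *)

Section State.

Variables (K : fieldType) (n m : nat) (A : 'M[K]_n) (N : 'M[K]_(n, m)).

Fixpoint state (u : nat -> 'cV[K]_m) (x0 : 'cV[K]_n) (k : nat) : 'cV[K]_n :=
  if k is j.+1 then A *m state u x0 j + N *m u j else x0.

Lemma eq_state (u v : nat -> 'cV[K]_m) x0 k :
  (forall i, (i < k)%N -> u i = v i) -> state u x0 k = state v x0 k.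
Proof.
elim: k => //= k IHk euv; rewrite euv // IHk // => i ltik.
exact/euv/ltnW.
Qed.

Lemma stateE u x0 k :
  state u x0 k = A ^+ k *m x0 + \sum_(i < k) A ^+ i *m N *m u (k - i.+1)%N.
Proof.
elim: k => [|k IHk] /=; first by rewrite big_ord0 expr0 mul1mx addr0.
rewrite IHk mulmxDr mulmxA -[A *m A ^+ k]exprS -addrA; congr (_ + _).
rewrite big_ord_recl /= expr0 mul1mx subn1 /= addrC mulmx_sumr.
by congr (_ + _); apply: eq_bigr => i _; rewrite !mulmxA -[A *m _]exprS.
Qed.

(** Column vectors of height n * m are families of n inputs, so full row rank is
solvability of the block equations. *)
Lemma controllability_rankP :
  \rank (controllability_mx A N) = n <->
  forall w : 'cV[K]_n, exists u : nat -> 'cV[K]_m,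
    w = \sum_(i < n) A ^+ i *m N *m u i.
Proof.
set C := controllability_mx A N; split=> [rC w | spanC].
  have freeC : row_free C by rewrite /row_free rC.
  set z := pinvmx C *m w.
  have wE : w = C *m z by rewrite mulmxA mulmxVp // mul1mx.
  exists (fun i => if insub i is Some j then submxcol z j else 0).
  rewrite wE -{1}(submxcolK z) mul_mxrow_mxcol.
  by apply: eq_bigr => i _; rewrite valK.
apply/eqP; rewrite -mxrank_tr -[_ == _]/(row_full C^T) -sub1mx.
apply/row_subP => i; have [u wE] := spanC (row i 1%:M)^T.
have -> : row i 1%:M = (\mxcol_(j < n) u j)^T *m C^T.
  by rewrite -trmx_mul mul_mxrow_mxcol -wE trmxK.
exact: submxMl.
Qed.

(** By Cayley-Hamilton, A ^+ k is the value at A of the remainder of X^k modulo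
the characteristic polynomial. *)
Lemma exprmx_span k :
  exists c : nat -> K, A ^+ k = \sum_(i < n) c i *: A ^+ i.
Proof.
case: n A => [|n'] A'; first by exists (fun=> 0); rewrite [LHS]flatmx0 [RHS]flatmx0.
pose r := 'X^k %% char_poly A'; exists (fun i => r`_i).
have le_r : (size r <= n'.+1)%N.
  by rewrite -ltnS -(size_char_poly A') ltn_modp monic_neq0 ?char_poly_monic.
have rE : r = \sum_(i < n'.+1) r`_i *: 'X^i.
  apply/polyP => i; rewrite -poly_def coef_poly; case: ltnP => // le_n_i.
  by rewrite nth_default // (leq_trans le_r).
transitivity (horner_mx A' r).
  rewrite -{1}(horner_mx_X A') -rmorphXn /= {1}(divp_eq 'X^k (char_poly A')).
  by rewrite rmorphD rmorphM /= Cayley_Hamilton mulr0 add0r.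
rewrite {1}rE rmorph_sum; apply: eq_bigr => i _.
by rewrite /= linearZ /= rmorphXn /= horner_mx_X.
Qed.

Lemma state0_span u k :
  exists v : nat -> 'cV[K]_m, state u 0 k = \sum_(i < n) A ^+ i *m N *m v i.
Proof.
elim: k => [|k [v IHk]] /=.
  by exists (fun=> 0); rewrite big1 // => i _; rewrite mulmx0.
have [c An] := exprmx_span n.
pose v1 i := if i is j.+1 then v j else u k.
(* One more step shifts the coefficients; the new power A ^+ n is then folded
   back. *)
exists (fun i => v1 i + c i *: v1 n).
transitivity (\sum_(i < n.+1) A ^+ i *m N *m v1 i).
  rewrite big_ord_recl /= expr0 mul1mx IHk mulmx_sumr addrC; congr (_ + _).
  by apply: eq_bigr => i _; rewrite !mulmxA -[A *m _]exprS.
rewrite big_ord_recr /= An !mulmx_suml -big_split /=.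
apply: eq_bigr => i _.
by rewrite mulmxDr -!scalemxAl -scalemxAr.
Qed.

(** With zero inputs up to time k - n, the last n inputs suffice to cancel the
free motion [A ^+ k *m x0] and add the target. *)
Lemma state_reach k x0 w :
  \rank (controllability_mx A N) = n -> (n <= k)%N ->
  exists u, state u x0 k = w.
Proof.
move=> /controllability_rankP spanC le_nk.
have [v vE] := spanC (w - A ^+ k *m x0).
exists (fun j => if (k - j.+1 < n)%N then v (k - j.+1)%N else 0).
rewrite stateE.
suff -> : \sum_(i < k) A ^+ i *m N *m
      (if (k - (k - i.+1).+1 < n)%N then v (k - (k - i.+1).+1)%N else 0)
    = w - A ^+ k *m x0 by rewrite addrC subrK.
rewrite vE (big_ord_widen k (fun i => A ^+ i *m N *m v i)) // [RHS]big_mkcond.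
apply: eq_bigr => i _; rewrite (subnSK (ltn_ord i)) (subKn (ltnW (ltn_ord i))).
by case: ifP => // _; rewrite mulmx0.
Qed.

End State.

(** * Trajectories of the system *)

Section Trajectory.

Variables (K : fieldType) (m M : nat) (F G B P Q : 'M[K]_m).
Variables (p q : nat) (epq : (p + q = m)%N).
Variables (J : 'M[K]_p) (H : 'M[K]_q) (Bp : 'M[K]_(p, m)) (Bq : 'M[K]_(q, m)).
Hypothesis unitP : P \in unitmx.
Hypothesis PFQ : P *m F *m Q = block_diag epq 1%:M H.
Hypothesis PGQ : P *m G *m Q = block_diag epq J 1%:M.
Hypothesis PB : P *m B = stack epq Bp Bq.

(** Multiplying the equation on the left by the invertible P decouples it. *)
Lemma step_blocks (a a' : 'cV[K]_p) (b b' : 'cV[K]_q) (v : 'cV[K]_m) :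
  F *m (Q *m stack epq a' b') = G *m (Q *m stack epq a b) + B *m v <->
  a' = J *m a + Bp *m v /\ H *m b' = b + Bq *m v.
Proof.
have PE : P *m (F *m (Q *m stack epq a' b')) = stack epq a' (H *m b').
  by rewrite !mulmxA PFQ mul_block_diag_stack mul1mx.
have PE' : P *m (G *m (Q *m stack epq a b) + B *m v)
    = stack epq (J *m a + Bp *m v) (b + Bq *m v).
  by rewrite mulmxDr !mulmxA PGQ PB mul_block_diag_stack mul1mx mul_stack stackD.
split=> [/(congr1 (mulmx P)) | [ea eb]].
  by rewrite PE PE' => /stack_inj.
by rewrite -[LHS](mulKmx unitP) PE ea eb -PE' mulKmx.
Qed.

(** The inputs of the backward recursion are read from time M - 1 down, and
carry a minus sign because Y^q_k = Hq Y^q_(k+1) - Bq V_k. *)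
Lemma trajectoryE V y0 yM Y :
  trajectory F G B Q epq M V y0 yM Y <->
  forall k, (k <= M)%N ->
    Y k = stack epq (state J Bp V y0 k)
                    (state H Bq (fun j => - V (M - j.+1)%N) yM (M - k)).
Proof.
split=> [[sol [yq Y0] [yp YM]] k le_kM | YE].
  have step j a b a' b' : (j < M)%N -> Y j = stack epq a b ->
      Y j.+1 = stack epq a' b' ->
      a' = J *m a + Bp *m V j /\ H *m b' = b + Bq *m V j.
    by move=> lt_jM Ej Ej'; apply/step_blocks; rewrite -Ej -Ej'; apply: sol.
  have [a [b Yk]] := stack_surj epq (Y k).
  have -> : state J Bp V y0 k = a.
    elim: k le_kM a b Yk => [|k IHk] le_kM a b Yk.
      by move: Yk; rewrite Y0 => /stack_inj[].
    have [a1 [b1 Yk1]] := stack_surj epq (Y k).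
    have [-> _] := step _ _ _ _ _ le_kM Yk1 Yk.
    by rewrite /= (IHk (ltnW le_kM) _ _ Yk1).
  (* The backward component is found by induction on the time M - k left. *)
  suff -> : state H Bq (fun j => - V (M - j.+1)%N) yM (M - k) = b by [].
  have : k = (M - (M - k))%N by rewrite subKn.
  move: (M - k)%N (leq_subr k M) => j; elim: j k a b le_kM Yk => [|j IHj].
    by move=> k a b _ Yk _ kE; move: Yk; rewrite kE subn0 YM => /stack_inj[].
  move=> k a b le_kM Yk lt_jM kE /=.
  have lt_kM : (k < M)%N by rewrite kE ltn_subrL (leq_ltn_trans _ lt_jM).
  have [a1 [b1 Yk1]] := stack_surj epq (Y k.+1).
  have [_ eb] := step _ _ _ _ _ lt_kM Yk Yk1.
  have k1E : k.+1 = (M - j)%N by rewrite kE subnSK.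
  by rewrite (IHj _ _ _ lt_kM Yk1 (ltnW lt_jM) k1E) -kE eb mulmxN addrK.
split.
- move=> k lt_kM; rewrite (YE _ lt_kM) (YE _ (ltnW lt_kM)); apply/step_blocks.
  split=> //; rewrite -(subnSK lt_kM) /= subnSK // subKn ?(ltnW lt_kM) //.
  by rewrite mulmxN subrK.
- by rewrite YE //=; eexists.
- by rewrite YE // subnn /=; eexists.
Qed.

End Trajectory.

(** * The criterion *)

Theorem theorem5p1 (K : fieldType) (m M : nat) (F G B : 'M[K]_m)
  (F_singular : F \notin unitmx) (FG_regular : regular_pencil F G)
  (p q : nat) (epq : (p + q = m)%N) (P Q : 'M[K]_m)
  (Jp : 'M[K]_p) (Hq : 'M[K]_q) (Bp : 'M[K]_(p, m)) (Bq : 'M[K]_(q, m))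
  (FG_form : weierstrass_form F G P Q epq Jp Hq)
  (PB_blocks : P *m B = stack epq Bp Bq) :
  ((m <= M)%N ->
     (controllable F G B Q epq M <->
      \rank (controllability_mx Jp Bp) = p /\
      \rank (controllability_mx Hq Bq) = q)) /\
  (controllable F G B Q epq M ->
     \rank (controllability_mx Jp Bp) = p /\
     \rank (controllability_mx Hq Bq) = q).
Proof.
have [[unitP _] PFQ PGQ _ _] := FG_form.
have trajE := trajectoryE M unitP PFQ PGQ PB_blocks.
have necessity : controllable F G B Q epq M ->
    \rank (controllability_mx Jp Bp) = p /\
    \rank (controllability_mx Hq Bq) = q.
  move=> ctrl; split; apply/controllability_rankP => w.
    have [k [V [Y [le_kM /trajE YE Yk]]]] := ctrl (stack epq w 0) 0 0.
    by move: Yk; rewrite YE // => /stack_inj[<- _]; apply: state0_span.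
  have [k [V [Y [le_kM /trajE YE Yk]]]] := ctrl (stack epq 0 w) 0 0.
  by move: Yk; rewrite YE // => /stack_inj[_ <-]; apply: state0_span.
split=> // le_mM; split=> // -[rankp rankq] W y0 yM.
have le_pM : (p <= M)%N by rewrite (leq_trans _ le_mM) // -epq leq_addr.
have le_q : (q <= M - p)%N by rewrite leq_subRL // epq.
have [a [b ->]] := stack_surj epq W.
have [u uE] := state_reach y0 a rankp (leqnn p).
have [v vE] := state_reach yM b rankq le_q.
(* v is indexed by the time left before M. *)
pose V i := if (i < p)%N then u i else - v (M - i.+1)%N.
pose Y k := stack epq (state Jp Bp V y0 k)
                      (state Hq Bq (fun j => - V (M - j.+1)%N) yM (M - k)).
exists p, V, Y; split=> //; first by apply/trajE.
rewrite /Y -uE -vE; congr stack; apply: eq_state => i lt_i.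
  by rewrite /V lt_i.
have lt_iM : (i < M)%N by rewrite (leq_trans lt_i) ?leq_subr.
have le_pi : (p <= M - i.+1)%N by rewrite leq_subRL // addnC -leq_subRL.
by rewrite /V ltnNge le_pi /= opprK subnSK // subKn // ltnW.
Qed.
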